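(* Consider the functionals $\{\mathcal F_\beta^m\}_{m}$ defined on $\mathcal P(\Omega)\cap L^\infty(\Omega)$ equipped with the weak-$*$ topology of $L^\infty(\Omega)$. Then, for any fixed $\beta>0$, $$\mathcal F^\infty=\Gamma\text{-}\lim_{m\to\infty}\mathcal F_\beta^m,$$ where $$\mathcal F^\infty(\rho)=\begin{cases}\dfrac12\displaystyle\iint_{\Omega\times\Omega}W(x-y)\rho(x)\rho(y)\,dx\,dy,&\|\rho\|_{L^\infty(\Omega)}\le1,\\ +\infty,&\text{otherwise.}\end{cases}$$
   Context: $\Omega=\mathbb T^d$ is the torus of side length $L>0$; $\mathcal P(\Omega)$ is the set of Borel probability measures on $\Omega$, identified with their densities when these exist. $W\in C^2(\Omega)$ is even along every coordinate and has mean zero. For $m>1$, $$\mathcal F_\beta^m(\rho)=\frac{\beta^{-1}}{m-1}\int_\Omega\rho^m\,dx-\frac{\beta^{-1}}{m-1}+\frac12\iint_{\Omega\times\Omega}W(x-y)\rho(x)\rho(y)\,dx\,dy$$ whenever these quantities are finite, and $+\infty$ otherwise. $\Gamma$-convergence is understood sequentially: (i) for every $\rho$ there is a recovery sequence $\rho_m\rightharpoonup\rho$ weak-$*$ with $\limsup_{m\to\infty}\mathcal F_\beta^m(\rho_m)\le\mathcal F^\infty(\rho)$; (ii) for every $\rho_m\rightharpoonup\rho$ weak-$*$, $\liminf_{m\to\infty}\mathcal F_\beta^m(\rho_m)\ge\mathcal F^\infty(\rho)$. *)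

(* Defs.v *)
From HB Require Import structures.
From mathcomp Require Import all_boot all_order all_algebra.
From mathcomp Require Import all_classical all_reals all_analysis.

Set Implicit Arguments.
Unset Strict Implicit.
Unset Printing Implicit Defensive.

Import Order.TTheory GRing.Theory Num.Theory.
Import numFieldNormedType.Exports.

Local Open Scope classical_set_scope.
Local Open Scope ring_scope.

(* The torus of side length L is R^d / (L Z)^d. A function on the torus is
   either a periodic function on R^d (the interaction potential, whose
   regularity matters) or, when only its class up to null sets matters, a
   function considered on the fundamental domain [0, L[^d (the densities).
   [torus_measure L d] is the d-dimensional Lebesgue measure restricted to
   [0, L[^d, so that an integral over the torus is an integral over [setT] for
   this measure. *)
Section torus_measure.
Context {R : realType}.
Variable L : R.

Definition circle_measure : set (measurableTypeR R) -> \bar R :=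
  mrestr lebesgue_measure (measurable_itv `[0, L[).

HB.instance Definition _ := Measure.on circle_measure.

Lemma fin_num_circle_measure : fin_num_fun circle_measure.
Proof.
apply: lty_fin_num_fun.
change (lebesgue_measure ([set: R] `&` [set` `[0%R, L[]) < +oo)%E.
by rewrite setTI lebesgue_measure_itv/=; case: ifP => _; rewrite ?ltry.
Qed.

HB.instance Definition _ :=
  Measure_isFinite.Build _ _ _ circle_measure fin_num_circle_measure.

Definition tuple_cons n (z : measurableTypeR R * n.-tuple (measurableTypeR R)) :
  n.+1.-tuple (measurableTypeR R) := [tuple of z.1 :: z.2].

Lemma measurable_tuple_cons n : measurable_fun setT (@tuple_cons n).
Proof. exact: measurable_cons. Qed.

Section torus_step.
Variables (n : nat).
Variable m : {finite_measure set (n.-tuple (measurableTypeR R)) -> \bar R}.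

Definition torus_step : set (n.+1.-tuple (measurableTypeR R)) -> \bar R :=
  pushforward (circle_measure \x m)%E (@tuple_cons n).

HB.instance Definition _ := Measure.copy torus_step
  (measure_function_pushforward__canonical__measure_function_Measure
    (circle_measure \x m)%E (@measurable_tuple_cons n)).

Lemma fin_num_torus_step : fin_num_fun torus_step.
Proof.
apply: lty_fin_num_fun.
change ((circle_measure \x m)%E (@tuple_cons n @^-1` setT) < +oo)%E.
rewrite preimage_setT -setXTT product_measure1E//.
apply: lte_mul_pinfty => //; first exact: fin_num_circle_measure.
exact/fin_num_fun_lty/fin_num_measure.
Qed.

HB.instance Definition _ :=
  Measure_isFinite.Build _ _ _ torus_step fin_num_torus_step.

End torus_step.

Fixpoint torus_measure (n : nat) :
    {finite_measure set (n.-tuple (measurableTypeR R)) -> \bar R} :=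
  match n with
  | 0 => \d_([tuple])
  | n'.+1 => torus_step (torus_measure n')
  end.

Lemma torus_measure_box n (A : 'I_n -> set (measurableTypeR R)) :
  (forall i, measurable (A i)) ->
  torus_measure n [set x | forall i, A i (tnth x i)] =
  (\prod_(i < n) circle_measure (A i))%E.
Proof.
elim: n A => [|n IHn] A mA.
  by rewrite big_ord0 /= diracE mem_set//= => -[].
rewrite big_ord_recl/= -IHn//.
have mB : measurable [set x : n.-tuple (measurableTypeR R) |
    forall i, A (lift ord0 i) (tnth x i)].
  rewrite (_ : [set _ | _] = \bigcap_(i in [set: 'I_n])
      ((fun x : n.-tuple (measurableTypeR R) => tnth x i) @^-1`
        A (lift ord0 i))).
    apply: fin_bigcap_measurable => // i _.
    by rewrite -[X in measurable X]setTI; apply: measurable_tnth.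
  by apply/seteqP; split=> x /= Ax i => [_|]; exact: Ax.
rewrite /= /torus_step /pushforward -product_measure1E//.
congr (product_measure1 _ _ _); apply/seteqP; split=> -[x y] /=.
  by move=> Axy; split=> [|i]; [exact: (Axy ord0)|have := Axy (lift ord0 i);
    rewrite tnthS].
move=> [Ax Ay] i; have [->//|i0] := eqVneq i ord0.
by case: (unliftP ord0 i) i0 => [j ->|->]; rewrite ?eqxx// tnthS.
Qed.

End torus_measure.

(* Only the lift of a function on the torus to R^d carries the differentiable
   structure; ['rV_d] is the normed space R^d, [d.-tuple] the measurable one. *)
Section regularity.
Context {R : realType} {d : nat}.
Implicit Types f : 'rV[R]_d -> R.

Definition torus_periodic (L : R) f :=
  forall (i : 'I_d) (x : 'rV[R]_d), f (x + L *: delta_mx ord0 i) = f x.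

Fixpoint Cn (k : nat) f : Prop :=
  match k with
  | 0 => continuous f
  | k'.+1 => continuous f /\
      forall i : 'I_d, (forall x, derivable f x (delta_mx ord0 i)) /\
        Cn k' (fun x => 'D_(delta_mx ord0 i) f x)
  end.

Definition reflect_coord (i : 'I_d) (x : 'rV[R]_d) : 'rV[R]_d :=
  \row_j (if j == i then - x ord0 j else x ord0 j).

Definition coordinatewise_even f :=
  forall (i : 'I_d) (x : 'rV[R]_d), f (reflect_coord i x) = f x.

Definition row_of_tuple (x : d.-tuple (measurableTypeR R)) : 'rV[R]_d :=
  \row_i (tnth x i : R).

End regularity.

(* P(Omega) `&` L^oo(Omega), each element being given by a representative of
   its density with respect to mu. *)
Record bounded_density d (T : measurableType d) (R : realType)
    (mu : {measure set T -> \bar R}) := BoundedDensity {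
  density_fun :> T -> R ;
  density_Linfty : density_fun \in Lfun mu +oo%E ;
  density_ge0 : {ae mu, forall x, 0 <= density_fun x} ;
  density_mass : (\int[mu]_x (density_fun x)%:E = 1)%E }.

Definition weak_star_cvg d (T : measurableType d) (R : realType)
    (mu : {measure set T -> \bar R}) (rho_ : nat -> bounded_density mu)
    (rho : bounded_density mu) : Prop :=
  forall phi : T -> R, phi \in Lfun mu 1%E ->
    (\int[mu]_x (rho_ n x * phi x)%:E @[n --> \oo] -->
     \int[mu]_x (rho x * phi x)%:E)%E.

Definition sequential_Gamma_lim (R : realType) (X : Type)
    (cvg_to_X : (nat -> X) -> X -> Prop)
    (F_ : nat -> X -> \bar R) (F : X -> \bar R) : Prop :=
  (forall x, exists2 x_ : nat -> X, cvg_to_X x_ x &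
     (limn_esup (fun n => F_ n (x_ n)) <= F x)%E) /\
  (forall x_ x, cvg_to_X x_ x ->
     (F x <= limn_einf (fun n => F_ n (x_ n)))%E).

(* Gamma-convergence as the continuous parameter tends to +oo, i.e., along
   every sequence of parameters > 1 tending to +oo. *)
Definition Gamma_lim_pinfty (R : realType) (X : Type)
    (cvg_to_X : (nat -> X) -> X -> Prop)
    (F_ : R -> X -> \bar R) (F : X -> \bar R) : Prop :=
  forall m_ : nat -> R, (forall n, 1 < m_ n) -> m_ n @[n --> \oo] --> +oo ->
    sequential_Gamma_lim cvg_to_X (fun n => F_ (m_ n)) F.

Section functionals.
Context {R : realType} {d : nat}.
Variables (L : R) (W : 'rV[R]_d -> R).

Local Notation mu := (torus_measure L d).

Definition interaction_integrand (rho : bounded_density mu)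
    (z : d.-tuple (measurableTypeR R) * d.-tuple (measurableTypeR R)) : \bar R :=
  (W (row_of_tuple z.1 - row_of_tuple z.2) * rho z.1 * rho z.2)%:E.

Definition interaction_energy (rho : bounded_density mu) : \bar R :=
  ((2^-1)%:E * \int[(mu \x mu)%E]_z interaction_integrand rho z)%E.

Definition free_energy (beta m : R) (rho : bounded_density mu) : \bar R :=
  if `[< mu.-integrable setT (fun x => (rho x `^ m)%:E) /\
         (mu \x mu)%E.-integrable setT (interaction_integrand rho) >]
  then ((beta^-1 / (m - 1))%:E * \int[mu]_x (rho x `^ m)%:E
        - (beta^-1 / (m - 1))%:E + interaction_energy rho)%E
  else +oo%E.

Definition limit_energy (rho : bounded_density mu) : \bar R :=
  if (Lnorm mu +oo (EFin \o rho) <= 1)%E then interaction_energy rho else +oo%E.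

End functionals.

(* Main.v *)
Require Import Defs.
From HB Require Import structures.
From mathcomp Require Import all_boot all_order all_algebra.
From mathcomp Require Import all_classical all_reals all_analysis.
From mathcomp Require Import measurable_realfun ess_sup_inf.
From mathcomp Require Import ring lra.

Set Implicit Arguments.
Unset Strict Implicit.
Unset Printing Implicit Defensive.

Import Order.TTheory GRing.Theory Num.Theory.
Import numFieldNormedType.Exports.

Local Open Scope classical_set_scope.
Local Open Scope ring_scope.

(** The functional is a sum of an entropy, of order (integral of rho^m) / (m - 1),
    and of an interaction that does not depend on m. The two parts behave
    independently.

    The interaction is continuous for weak-star convergence
    ([interaction_cvg]). Since W is uniformly continuous on the compact cube
    [-L, L]^d, cutting the fundamental domain into small boxes makes
    W (x - y) uniformly close to a kernel that is constant on products of boxes.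
    For such a kernel the double integral is a finite sum of products of the
    masses that the density gives to the boxes, and these masses converge. As all
    densities have mass one, a uniform error e on the kernel is an error at most e on
    the double integral, whatever the density ([interaction_dist]).

    The entropy is negligible when rho <= 1 and forces rho <= 1 in the limit.
    If 0 <= rho <= 1 then rho^m <= rho has mass at most one, so that the entropy of
    rho, normalized to vanish at mass one, is nonpositive, and the constant sequence
    recovers the limit energy ([free_energy_le]). For a lower bound the entropy is
    at least - beta^-1 / (m - 1), which tends to 0; with the continuity of the interaction
    this is the liminf inequality for a limit density bounded by 1
    ([free_energy_liminf]). If the limit density exceeds some b > 1 on a
    set A of positive measure, choose a between 1 and b: eventually rho_n has mass at
    least a |A| on A, hence the integral of rho_n^m is at least
    a^m |A| by Jensen's inequality ([powR_mass_ge]). Since a^m / (m - 1) grows at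
    least linearly in m ([powR_superlinear]), the energies blow up
    ([free_energy_blowup]). *)

(** * Tensor products on a product measure *)

Lemma integrable_ae_le d (T : measurableType d) (R : realType)
    (m : {measure set T -> \bar R}) (f g : T -> \bar R) :
  measurable_fun setT f -> {ae m, forall x, (`|f x| <= `|g x|)%E} ->
  m.-integrable setT g -> m.-integrable setT f.
Proof.
move=> mf fg /integrableP[mg goo]; apply/integrableP; split => //.
apply: le_lt_trans goo; apply: ae_ge0_le_integral => //.
- exact: measurableT_comp.
- exact: measurableT_comp.
- by apply: filterS fg => x fgx _.
Qed.

Section tensor.
Context d (T : measurableType d) (R : realType).
Variable mu : {finite_measure set T -> \bar R}.
Local Notation mu2 := (mu \x mu)%E.

(** The exceptional set is contained in two cylinders over null sets. *)
Lemma ae_prod (P Q : T -> Prop) :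
  {ae mu, forall x, P x} -> {ae mu, forall y, Q y} ->
  {ae mu2, forall z, P z.1 /\ Q z.2}.
Proof.
move=> [N [mN N0 PN]] [M [mM M0 QM]].
exists (N `*` setT `|` setT `*` M); split.
- by apply: measurableU; exact: measurableX.
- have null A B : measurable A -> measurable B ->
      (mu A * mu B = 0)%E -> mu2.-negligible (A `*` B).
    move=> mA mB AB0; apply/negligibleP; first exact: measurableX.
    by rewrite -AB0; exact: product_measure1E.
  have : mu2.-negligible (N `*` setT `|` setT `*` M).
    by apply: negligibleU; apply: null => //; rewrite ?N0 ?M0 ?mul0e ?mule0.
  by move/negligibleP; apply; apply: measurableU; exact: measurableX.
- move=> -[x y] /= /not_andP[nP|nQ]; [left|right]; split=> //=.
  + exact: PN.
  + exact: QM.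
Qed.

Lemma integrable_tensor (f g : T -> R) :
  mu.-integrable setT (EFin \o f) -> mu.-integrable setT (EFin \o g) ->
  mu2.-integrable setT (fun z => (f z.1 * g z.2)%:E).
Proof.
move=> intf intg.
have mf : measurable_fun setT f.
  by apply/measurable_EFinP; exact: measurable_int intf.
have mg : measurable_fun setT g.
  by apply/measurable_EFinP; exact: measurable_int intg.
apply/integrable12ltyP.
  apply/measurable_EFinP; apply: measurable_funM.
    exact: (measurableT_comp mf).
  exact: (measurableT_comp mg).
under eq_integral => x _.
  under eq_integral => y _ do rewrite /= normrM EFinM.
  rewrite ge0_integralZl_EFin//; first over.
  by apply/measurable_EFinP; exact: measurableT_comp.
rewrite /= ge0_integralZr//.
- apply: lte_mul_pinfty.
  + exact: integral_ge0.
  + by apply: integrable_fin_num => //; exact: (integrable_norm intf).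
  + by apply: integrable_lty => //; exact: (integrable_norm intg).
- by apply/measurable_EFinP; exact: measurableT_comp.
- exact: integral_ge0.
Qed.

Lemma integral_tensor (f g : T -> R) :
  mu.-integrable setT (EFin \o f) -> mu.-integrable setT (EFin \o g) ->
  (\int[mu2]_z (f z.1 * g z.2)%:E =
   (\int[mu]_x (f x)%:E) * (\int[mu]_y (g y)%:E))%E.
Proof.
move=> intf intg.
rewrite -(integral12_prod_meas1 (integrable_tensor intf intg)) /fubini_F.
under eq_integral => x _ do
  rewrite /= (integralZl measurableT intg (f x)).
have /fineK <- := integrable_fin_num measurableT intg.
exact: (integralZr measurableT intf).
Qed.

End tensor.

(** * Interaction energies of bounded kernels *)

Section densities.
Context d (T : measurableType d) (R : realType).
Variable mu : {finite_measure set T -> \bar R}.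
Local Notation mu2 := (mu \x mu)%E.
Implicit Types rho : bounded_density mu.

Lemma measurable_density rho : measurable_fun setT rho.
Proof. by have /andP[/[!inE]] := density_Linfty rho. Qed.

(** A density is nonnegative only almost everywhere; passing to its absolute
    value gives a function that is nonnegative everywhere and still has mass one. *)
Lemma integral_norm_density rho : (\int[mu]_x `|rho x|%:E = 1)%E.
Proof.
rewrite -(density_mass rho); apply: ae_eq_integral => //.
- apply/measurable_EFinP; apply: measurableT_comp => //.
  exact: measurable_density.
- by apply/measurable_EFinP; exact: measurable_density.
- by apply: filterS (density_ge0 rho) => x rho0 _; rewrite ger0_norm.
Qed.

Lemma integrable_density rho : mu.-integrable setT (EFin \o rho).
Proof.
apply/integrableP; split.
  by apply/measurable_EFinP; exact: measurable_density.
by under eq_integral do rewrite /=; rewrite integral_norm_density ltry.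
Qed.

Lemma integrable_bounded_kernel (K : T * T -> R) (C : R) rho :
  measurable_fun setT K -> {ae mu2, forall z, `|K z| <= C} ->
  mu2.-integrable setT (fun z => (K z * rho z.1 * rho z.2)%:E).
Proof.
move=> mK KC.
have mrho := measurable_density rho.
have int2 := integrable_tensor (integrable_density rho) (integrable_density rho).
apply: (@integrable_ae_le _ _ _ _ _ (fun z => (C * (rho z.1 * rho z.2))%:E)).
- apply/measurable_EFinP; apply: measurable_funM.
    by apply: measurable_funM => //; exact: (measurableT_comp mrho).
  exact: (measurableT_comp mrho).
- apply: filterS KC => z KC; rewrite /= lee_fin -mulrA !normrM.
  by rewrite ler_wpM2r ?mulr_ge0// (le_trans KC)// ler_norm.
- by under eq_fun do rewrite EFinM; exact: integrableZl.
Qed.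

Lemma integrable_density_indic rho (A : set T) : measurable A ->
  mu.-integrable setT (fun x => (rho x * \1_A x)%:E).
Proof.
move=> mA; apply: (le_integrable _ _ _ (integrable_density rho)) => //.
  apply/measurable_EFinP; apply: measurable_funM => //.
  exact: measurable_density.
move=> x _; rewrite lee_fin normrM ler_piMr// indicE.
by case: (_ \in _); rewrite ?normr1 ?normr0.
Qed.

(** The only test functions that the convergence of the interaction needs are
    indicators. *)
Lemma weak_star_cvg_set (rho_ : nat -> bounded_density mu) rho (A : set T) :
  measurable A -> weak_star_cvg rho_ rho ->
  \int[mu]_x (rho_ n x * \1_A x) @[n --> \oo] --> \int[mu]_x (rho x * \1_A x).
Proof.
move=> mA rho_cvg.
have L1 : (\1_A : T -> R) \in Lfun mu 1.
  by apply/Lfun1_integrable; exact: integrable_indic.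
apply: fine_cvg; rewrite /Rintegral fineK; first exact: rho_cvg.
by apply: integrable_fin_num => //; exact: integrable_density_indic.
Qed.

Lemma integral_norm_density2 rho :
  (\int[mu2]_z (`|rho z.1| * `|rho z.2|)%:E = 1)%E.
Proof.
have intn := integrable_norm (integrable_density rho).
by rewrite (integral_tensor intn intn) integral_norm_density mule1.
Qed.

(** The product density has mass one, so the interaction is 1-Lipschitz in the
    kernel for the uniform distance, with the same constant for all densities. *)
Lemma interaction_dist (K K' : T * T -> R) (C C' e : R) rho :
  measurable_fun setT K -> measurable_fun setT K' ->
  {ae mu2, forall z, `|K z| <= C} -> {ae mu2, forall z, `|K' z| <= C'} ->
  0 <= e -> {ae mu2, forall z, `|K z - K' z| <= e} ->
  `|\int[mu2]_z (K z * rho z.1 * rho z.2) -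
    \int[mu2]_z (K' z * rho z.1 * rho z.2)| <= e.
Proof.
move=> mK mK' KC KC' e0 KK'.
have intK := integrable_bounded_kernel rho mK KC.
have intK' := integrable_bounded_kernel rho mK' KC'.
have intn := integrable_norm (integrable_density rho).
have intD : mu2.-integrable setT (fun z =>
    (K z * rho z.1 * rho z.2 - K' z * rho z.1 * rho z.2)%:E).
  by under eq_fun do rewrite EFinB; exact: integrableB.
rewrite -RintegralB//.
apply: (le_trans (le_normr_Rintegral _ _)) => //.
rewrite -lee_fin /Rintegral fineK; last first.
  by apply: integrable_fin_num => //; exact: integrable_norm.
rewrite -[leRHS]mule1 -(integral_norm_density2 rho).
rewrite -(integralZl measurableT (integrable_tensor intn intn)).
apply: ae_ge0_le_integral => //.
- exact: (measurable_int mu2 (integrable_norm intD)).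
- by move=> z _; rewrite -EFinM lee_fin !mulr_ge0//=.
- apply: (measurable_int mu2); apply: integrableZl => //.
  exact: (integrable_tensor intn intn).
- apply: filterS KK' => z KK' _.
  rewrite -EFinM lee_fin -!mulrA -mulrBl !normrM.
  by rewrite ler_wpM2r ?mulr_ge0.
Qed.

(** The map q cuts the space into the finitely many cells on which the
    approximating kernel c is constant in each variable. *)
Definition step_approximable (K : T * T -> R) := forall e : R, 0 < e ->
  exists (I : finType) (q : T -> I) (c : I -> I -> R),
    (forall i, measurable (q @^-1` [set i])) /\
    {ae mu2, forall z, `|K z - c (q z.1) (q z.2)| <= e}.

Section step_kernel.
Variables (I : finType) (q : T -> I) (c : I -> I -> R).
Hypothesis mq : forall i, measurable (q @^-1` [set i]).

Local Notation cell i := (q @^-1` [set i]).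

(** Exactly one pair of cells contains z, so a step kernel is a finite sum of tensor
    products. *)
Lemma step_kernelE (f : T -> R) z :
  c (q z.1) (q z.2) * f z.1 * f z.2 =
  \sum_(p : I * I) c p.1 p.2 *
    ((f z.1 * \1_(cell p.1) z.1) * (f z.2 * \1_(cell p.2) z.2)).
Proof.
rewrite (bigD1 (q z.1, q z.2))//= big1 ?addr0 => [|[i j] /= ne].
  by rewrite !indicE !mem_set//= !mulr1 mulrA.
suff : (\1_(cell i) z.1 : R) = 0 \/ (\1_(cell j) z.2 : R) = 0.
  by case=> ->; rewrite ?mulr0 ?mul0r ?mulr0.
have [qi|qi] := eqVneq (q z.1) i.
  right; rewrite indicE memNset//= => qj.
  by move: ne; rewrite qi qj eqxx.
by left; rewrite indicE memNset//=; exact/eqP.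
Qed.

Lemma measurable_step_kernel :
  measurable_fun setT (fun z : T * T => c (q z.1) (q z.2)).
Proof.
have -> : (fun z : T * T => c (q z.1) (q z.2)) = (fun z =>
    \sum_(p : I * I) c p.1 p.2 * (\1_(cell p.1) z.1 * \1_(cell p.2) z.2)).
  apply/funext => z; have := step_kernelE (fun=> 1) z.
  rewrite !mulr1 => ->.
  by apply: eq_bigr => p _; rewrite !mul1r.
have m1 i : measurable_fun setT (\1_(cell i) : T -> R).
  by apply: measurable_indic; exact: mq.
apply: measurable_sum => p; apply: measurable_funM => //.
by apply: measurable_funM; exact: (measurableT_comp (m1 _)).
Qed.

Lemma step_kernel_bounded :
  exists C : R, forall z, `|c (q z.1) (q z.2)| <= C.
Proof.
exists (\sum_(p : I * I) `|c p.1 p.2|) => z.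
by rewrite (bigD1 (q z.1, q z.2))//= lerDl sumr_ge0.
Qed.

(** The interaction sees the density only through the masses of the cells. *)
Lemma step_interactionE rho :
  \int[mu2]_z (c (q z.1) (q z.2) * rho z.1 * rho z.2) =
  \sum_(p : I * I) c p.1 p.2 *
    (\int[mu]_x (rho x * \1_(cell p.1) x) *
     \int[mu]_x (rho x * \1_(cell p.2) x)).
Proof.
have int1 i := integrable_density_indic rho (mq i).
rewrite /Rintegral.
under eq_integral do rewrite step_kernelE -sumEFin.
rewrite integral_sum//; last first.
  move=> p; under eq_fun do rewrite EFinM; apply: integrableZl => //.
  exact: integrable_tensor (int1 p.1) (int1 p.2).
rewrite -sum_fine; last first.
  move=> p _; apply: integrable_fin_num => //.
  under eq_fun do rewrite EFinM; apply: integrableZl => //.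
  exact: integrable_tensor (int1 p.1) (int1 p.2).
apply: eq_bigr => p _.
under eq_integral do rewrite EFinM.
rewrite (integralZl measurableT (integrable_tensor (int1 p.1) (int1 p.2))).
rewrite (integral_tensor (int1 p.1) (int1 p.2)) !fineM ?integrable_fin_num//.
by rewrite fin_numM ?integrable_fin_num.
Qed.

Lemma step_interaction_cvg (rho_ : nat -> bounded_density mu) rho :
  weak_star_cvg rho_ rho ->
  \int[mu2]_z (c (q z.1) (q z.2) * rho_ n z.1 * rho_ n z.2) @[n --> \oo] -->
  \int[mu2]_z (c (q z.1) (q z.2) * rho z.1 * rho z.2).
Proof.
move=> rho_cvg; rewrite step_interactionE.
under eq_cvg do rewrite step_interactionE.
apply: cvg_big => [|p _]; first exact: add_continuous.
apply: cvgM; first exact: cvg_cst.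
by apply: cvgM; exact: weak_star_cvg_set.
Qed.

End step_kernel.

Lemma step_approximable_bounded (K : T * T -> R) : step_approximable K ->
  exists C : R, {ae mu2, forall z, `|K z| <= C}.
Proof.
move=> /(_ 1 ltr01)[I [q [c [_ Kc]]]].
have [C cC] := step_kernel_bounded q c.
exists (1 + C); apply: filterS Kc => z Kc.
by rewrite -(subrK (c (q z.1) (q z.2)) (K z)) (le_trans (ler_normD _ _))// lerD.
Qed.

Lemma integrable_interaction (K : T * T -> R) rho :
  measurable_fun setT K -> step_approximable K ->
  mu2.-integrable setT (fun z => (K z * rho z.1 * rho z.2)%:E).
Proof.
move=> mK /step_approximable_bounded[C KC].
exact: (integrable_bounded_kernel rho mK KC).
Qed.

(** The uniform bound of [interaction_dist] lets the limits in the step size and in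
    the densities be exchanged: an e/3 argument between the kernel and a step
    kernel. *)
Lemma interaction_cvg (K : T * T -> R) (rho_ : nat -> bounded_density mu) rho :
  measurable_fun setT K -> step_approximable K -> weak_star_cvg rho_ rho ->
  (\int[mu2]_z (K z * rho_ n z.1 * rho_ n z.2)%:E @[n --> \oo] -->
   \int[mu2]_z (K z * rho z.1 * rho z.2)%:E)%E.
Proof.
move=> mK stepK rho_cvg.
have intK r := integrable_interaction r mK stepK.
have [C KC] := step_approximable_bounded stepK.
rewrite -[X in _ --> X]fineK ?integrable_fin_num//.
apply: cvg_EFin; first by apply: nearW => n; exact: integrable_fin_num.
apply/cvgrPdist_le => e e0.
have e3 : 0 < e / 3 by rewrite divr_gt0.
have [I [q [c [mq Kc]]]] := stepK _ e3.
have [C' cC'] := step_kernel_bounded q c.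
have close r := interaction_dist r mK (measurable_step_kernel c mq) KC
  (aeW _ cC') (ltW e3) Kc.
have /cvgrPdist_le/(_ _ e3) := @step_interaction_cvg _ q c mq _ _ rho_cvg.
apply: filterS => n near_step.
have := close rho; have := close (rho_ n); move: near_step.
rewrite /Rintegral /= !ler_norml; lra.
Qed.

End densities.

(** * Continuous functions of a row vector *)

Section row_vectors.
Context (R : realType) (n : nat).

(** An open set is the union of the countably many cubes with rational centre and
    half-side 1/(k+1) that it contains, and the preimage of a cube is a finite
    intersection of conditions on the coordinates. *)
Lemma measurable_row_preimage d (T : measurableType d) (g : T -> 'rV[R]_n)
    (U : set 'rV[R]_n) :
  (forall i, measurable_fun setT (fun x => g x ord0 i)) -> open U ->
  measurable (g @^-1` U).
Proof.
move=> mg openU.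
pose cube (c : 'rV[rat]_n * nat) : set 'rV[R]_n :=
  [set u | forall i, `|u ord0 i - ratr (c.1 ord0 i)| < c.2.+1%:R^-1].
have -> : g @^-1` U =
    \bigcup_c (if `[< cube c `<=` U >] then g @^-1` cube c else set0).
  apply/seteqP; split=> [x /= Ugx|x [c _]]; last first.
    by case: asboolP => // cU /cU.
  have /nbhs_ballP[e /= e0 eU] := open_nbhs_nbhs (conj openU Ugx).
  (* Half of e: the cube around the rational centre must stay in the ball of
     radius e around the point. *)
  have [k [s [sE s0 se]]] : exists k : nat, exists s : R,
      [/\ k.+1%:R^-1 = s, 0 < s & s < e / 2].
    have [k] := ltr_add_invr (divr_gt0 e0 (ltr0n R 2)).
    by rewrite add0r => ke; exists k, k.+1%:R^-1; rewrite invr_gt0.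
  have near_rat i : exists p : rat, `|g x ord0 i - ratr p| < s.
    have : g x ord0 i - s < g x ord0 i + s by lra.
    move=> /rat_in_itvoo[p]; rewrite in_itv/= => /andP[p1 p2]; exists p.
    by rewrite ltr_norml; apply/andP; split; lra.
  have [p gp] := choice near_rat.
  exists (\row_i p i, k) => //; case: asboolP => [_ i|nsub] /=.
    by rewrite mxE sE.
  exfalso; apply: nsub => u cu; apply: eU; split => // i j.
  rewrite (ord1 i) /ball/=.
  have := cu j; have := gp j; rewrite /= mxE sE.
  move: (ratr (p j)) => r; rewrite !ltr_norml => /andP[? ?] /andP[? ?].
  by apply/andP; split; lra.
apply: countable_bigcupT_measurable => // c.
case: ifP => // _.
rewrite (_ : _ @^-1` _ = \bigcap_(i in [set: 'I_n])
    ((fun x => `|g x ord0 i - ratr (c.1 ord0 i)|) @^-1` `]-oo, c.2.+1%:R^-1[)).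
  apply: fin_bigcap_measurable => // i _.
  rewrite -[X in measurable X]setTI.
  have mh : measurable_fun setT (fun x => `|g x ord0 i - ratr (c.1 ord0 i)|).
    by apply: measurableT_comp => //; apply: measurable_funB.
  exact: mh.
apply/seteqP; split=> x /= xc i; first by move=> _; rewrite /= in_itv/=; exact: xc.
by have := xc i I; rewrite /= in_itv.
Qed.

Lemma measurable_fun_continuous_row d (T : measurableType d)
    (g : T -> 'rV[R]_n) (f : 'rV[R]_n -> R) :
  (forall i, measurable_fun setT (fun x => g x ord0 i)) -> continuous f ->
  measurable_fun setT (f \o g).
Proof.
move=> mg cf; apply: (measurability _ (RGenOInfty.measurableE R)).
move=> /= _ [_ [a ->]] <-; rewrite setTI comp_preimage.
apply: measurable_row_preimage => //.
by apply: open_comp => [x _|]; [exact: cf|exact: interval_open].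
Qed.

(** A finite cover of K makes the radius of continuity uniform. The point v may lie
    outside K, since continuity at a point of K controls all the nearby values. *)
Lemma uniformly_continuous_on_compact (f : 'rV[R]_n -> R) (K : set 'rV[R]_n)
    (e : R) :
  continuous f -> compact K -> 0 < e ->
  exists2 r : R, 0 < r & forall u v : 'rV[R]_n, K u ->
    (forall i, `|u ord0 i - v ord0 i| < r) -> `|f u - f v| <= e.
Proof.
move=> cf /compact_near_coveringP cK e0.
have e2 : 0 < e / 2 by rewrite divr_gt0.
pose P (r : R) (u : 'rV[R]_n) :=
  forall v : 'rV[R]_n, (forall i, `|u ord0 i - v ord0 i| < r) -> `|f u - f v| <= e.
have : \forall r \near 0^'+, K `<=` P r.
  apply: cK => u _.
  have /cvgrPdist_le/(_ _ e2)/nbhs_ballP[r /= r0 rf] := cf u.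
  have r2 : 0 < r / 2 by rewrite divr_gt0.
  exists (ball u (r / 2), [set s | s < r / 2]) => /=.
    split; first exact: nbhsx_ballx.
    exact: nbhs_right_lt.
  move=> [u' s] /= [[_ uu'] sr] v u'v.
  have fu' : `|f u - f u'| <= e / 2.
    apply: rf; split=> // i j; rewrite (ord1 i); have := uu' ord0 j.
    by rewrite /ball/= => /lt_trans; apply; lra.
  have fv : `|f u - f v| <= e / 2.
    apply: rf; split=> // i j; rewrite (ord1 i); have := uu' ord0 j; have := u'v j.
    by rewrite /ball/= !ltr_norml; lra.
  by move: fu' fv; rewrite !ler_norml; lra.
move=> nearP; near (0 : R)^'+ => r.
by exists r => // u v Ku; apply: (near nearP r).
Unshelve. all: by end_near. Qed.

End row_vectors.

(** * Step approximation of the convolution kernel on the torus *)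

Section torus.
Context (R : realType) (d : nat) (L : R).
Hypothesis L0 : 0 < L.
Local Notation mu := (torus_measure L d).
Local Notation X := (d.-tuple (measurableTypeR R)).
Implicit Types x y : X.

Definition fundamental_domain x := forall i, 0 <= tnth x i < L.

(** The complement is covered by the d sets where one coordinate leaves [0, L[, each
    a box with a null side. *)
Lemma ae_fundamental_domain : {ae mu, forall x, fundamental_domain x}.
Proof.
pose A (i j : 'I_d) : set (measurableTypeR R) :=
  if j == i then ~` `[0, L[%classic else setT.
have mA i j : measurable (A i j).
  by rewrite /A; case: ifP => // _; apply: measurableC; exact: measurable_itv.
have A0 i : mu.-negligible [set x | forall j, A i j (tnth x j)].
  apply/negligibleP.
    rewrite (_ : [set _ | _] = \bigcap_(j in [set: 'I_d])
        ((fun x : X => tnth x j) @^-1` A i j)).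
      apply: fin_bigcap_measurable => // j _.
      by rewrite -[X in measurable X]setTI; apply: measurable_tnth.
    by apply/seteqP; split=> x /= Ax j => [_|]; exact: Ax.
  apply: etrans; first exact: (torus_measure_box L (mA i)).
  rewrite (bigD1 i)//= /A eqxx /circle_measure /mrestr.
  by rewrite setICl measure0 mul0e.
change (mu.-negligible (~` [set x | fundamental_domain x])).
apply: (@negligibleS _ _ _ _
  (\big[setU/set0]_(i < d) [set x | forall j, A i j (tnth x j)])).
  move=> x /= /existsNP[i xi].
  rewrite (bigD1 i)//=; left => j.
  by rewrite /A; case: eqP => // ->; rewrite /= in_itv/=.
elim/big_ind: _ => // [|B C nB nC]; [exact: negligible_set0|exact: negligibleU].
Qed.

(** Instead of the integer parts of (N+1) x_i / L, the code records all the
    comparisons of the coordinates with the grid points k L / (N+1): it has the same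
    fibres on the fundamental domain, takes finitely many values on the whole space,
    and its fibres are visibly measurable. *)
Definition grid_code N (x : X) : {ffun 'I_d * 'I_N.+1 -> bool} :=
  [ffun p : 'I_d * 'I_N.+1 => p.2%:R * (L / N.+1%:R) <= tnth x p.1].

Lemma measurable_grid_cell N w : measurable (grid_code N @^-1` [set w]).
Proof.
rewrite (_ : _ @^-1` _ = \bigcap_(p in [set: 'I_d * 'I_N.+1])
  ((fun x : X => p.2%:R * (L / N.+1%:R) <= tnth x p.1) @^-1` [set w p])).
  apply: fin_bigcap_measurable => // p _.
  rewrite -[Y in measurable Y]setTI; apply: measurable_fun_ler => //.
  exact: measurable_tnth.
apply/seteqP; split=> x /=; first by move=> <- p _; rewrite ffunE.
by move=> xw; apply/ffunP => p; rewrite ffunE; exact: xw.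
Qed.

(** The last grid point below b is also below a. *)
Lemma same_grid_interval N (a b : R) : 0 <= a -> a <= b -> b < L ->
  (forall k : 'I_N.+1, k%:R * (L / N.+1%:R) <= b -> k%:R * (L / N.+1%:R) <= a) ->
  b - a < L / N.+1%:R.
Proof.
move=> a0 ab bL grid; set h := L / N.+1%:R in grid *.
have h0 : 0 < h by rewrite divr_gt0.
have bh0 : 0 <= b / h by apply: divr_ge0; [exact: le_trans ab|exact: ltW].
have /andP[kb bk] := truncn_itv bh0.
have kN : (Num.truncn (b / h) < N.+1)%N.
  rewrite -(ltr_nat R) (le_lt_trans kb)// ltr_pdivrMr// /h mulrC divfK//.
have := grid (Ordinal kN); rewrite /= -ler_pdivlMr// => /(_ kb).
move=> ka; move: bk; rewrite ltr_pdivrMr// -natr1 mulrDl mul1r => bk.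
by rewrite ltrBlDr (lt_le_trans bk)// addrC lerD2l.
Qed.

Lemma same_grid_code N x y :
  fundamental_domain x -> fundamental_domain y ->
  grid_code N x = grid_code N y ->
  forall i, `|tnth x i - tnth y i| < L / N.+1%:R.
Proof.
move=> xD yD xy i; have /andP[x0 xL] := xD i; have /andP[y0 yL] := yD i.
have grid (k : 'I_N.+1) : (k%:R * (L / N.+1%:R) <= tnth x i) =
    (k%:R * (L / N.+1%:R) <= tnth y i).
  by move/ffunP : xy => /(_ (i, k)); rewrite !ffunE.
have [lexy|/ltW leyx] := leP (tnth x i) (tnth y i).
  rewrite ler0_norm ?subr_le0// opprB; apply: same_grid_interval => // k.
  by rewrite grid.
by rewrite ger0_norm ?subr_ge0//; apply: same_grid_interval => // k; rewrite grid.
Qed.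

(** The value of the step kernel on a product of cells is the value of the kernel at
    chosen representatives of the two cells. *)
Lemma step_approximable_difference (W : 'rV[R]_d -> R) : continuous W ->
  step_approximable mu
    (fun z => W (row_of_tuple z.1 - row_of_tuple z.2)).
Proof.
move=> cW e e0.
pose Q : set 'rV[R]_d := [set u | forall i, `[- L, L]%classic (u ord0 i)].
have cQ : compact Q.
  by apply: (@rV_compact _ _ (fun=> `[- L, L]%classic)) => i; exact: segment_compact.
have [r r0 rW] := uniformly_continuous_on_compact cW cQ e0.
(* Both arguments of the difference are moved, each by less than r / 2. *)
have [N Nr] : exists N : nat, L / N.+1%:R < r / 2.
  have : 0 < r / 2 / L by rewrite !divr_gt0.
  move=> /ltr_add_invr[N]; rewrite add0r ltr_pdivlMr// mulrC => ?.
  by exists N.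
(* The zero tuple only serves cells that miss the fundamental domain. *)
pose rep w : X := xget [tuple of nseq d 0]
  [set x | fundamental_domain x /\ grid_code N x = w].
have repP x : fundamental_domain x ->
    fundamental_domain (rep (grid_code N x)) /\
    forall i, `|tnth x i - tnth (rep (grid_code N x)) i| < r / 2.
  move=> xD; rewrite /rep; case: xgetP => [y _ [yD yx]|/(_ x)[]//].
  by split=> // i; apply: lt_trans Nr; exact: same_grid_code.
exists {ffun 'I_d * 'I_N.+1 -> bool}, (grid_code N),
  (fun v w => W (row_of_tuple (rep v) - row_of_tuple (rep w))).
split=> [w|]; first exact: measurable_grid_cell.
apply: filterS (ae_prod ae_fundamental_domain ae_fundamental_domain).
move=> [x y] /= [xD yD]; have [_ xr] := repP _ xD; have [_ yr] := repP _ yD.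
apply: rW => [i|i].
  rewrite /= !mxE in_itv/=; have := xD i; have := yD i.
  by move=> /andP[? ?] /andP[? ?]; apply/andP; split; lra.
have := xr i; have := yr i; rewrite !mxE !ltr_norml.
by move=> /andP[? ?] /andP[? ?]; apply/andP; split; lra.
Qed.

Lemma measurable_difference_kernel (W : 'rV[R]_d -> R) : continuous W ->
  measurable_fun setT (fun z : X * X => W (row_of_tuple z.1 - row_of_tuple z.2)).
Proof.
move=> cW.
apply: (@measurable_fun_continuous_row _ _ _ _
  (fun z : X * X => row_of_tuple z.1 - row_of_tuple z.2)) => // i.
under eq_fun do rewrite !mxE.
by apply: measurable_funB; exact: (measurableT_comp (measurable_tnth i)).
Qed.

End torus.

(** * Bounds on limits inferior and superior *)

Section limit_bounds.
Local Open Scope ereal_scope.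
Context (R : realType).
Implicit Types u v : (\bar R)^nat.

Lemma limn_einf_ge_cvg u v (l : \bar R) :
  v n @[n --> \oo] --> l -> (\forall n \near \oo, v n <= u n) ->
  l <= limn_einf u.
Proof.
move=> vl [N _ vu]; rewrite -(cvg_limn_einf_sup vl).1 !limn_einf_lim.
apply: lee_lim; [exact: is_cvg_einfs|exact: is_cvg_einfs|].
exists N => // n /= Nn; apply/ereal_infP => _ [k /= nk <-].
apply: le_trans (vu k (leq_trans Nn nk)).
by apply: ereal_inf_lbound; exists k.
Qed.

Lemma limn_esup_le_bound u (l : \bar R) :
  (forall n, u n <= l) -> limn_esup u <= l.
Proof.
move=> ul; rewrite limn_esup_lim; apply: lime_le; first exact: is_cvg_esups.
by apply: nearW => n; apply/ereal_supP => _ [k _ <-].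
Qed.

End limit_bounds.

(** * Powers with a large exponent *)

Section powers.
Context (R : realType).
Implicit Types (a t m : R).

(** The graph of t^m lies above its tangent at a: this is Young's inequality for
    t / a and 1. For t < 0 the power is 1 by convention, while the tangent is
    negative, so the sign of t need not be known; this matters because a density is
    nonnegative only almost everywhere. *)
Lemma powR_ge_tangent a t m : 0 < a -> 1 < m ->
  a `^ m * (1 - m + m / a * t) <= t `^ m.
Proof.
move=> a0 m1.
have m0 : 0 < m by lra.
have am0 : 0 < a `^ m by exact: powR_gt0.
have [t0|t0] := ltP t 0.
  apply: le_trans (powR_ge0 _ _).
  rewrite pmulr_rle0//.
  have : m / a * t <= 0 by rewrite pmulr_rle0 ?divr_gt0// ltW.
  by lra.
have ta0 : 0 <= t / a by rewrite divr_ge0 // ltW.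
have q0 : 0 < m / (m - 1) by rewrite divr_gt0//; lra.
have mq : m^-1 + (m / (m - 1))^-1 = 1 by field; rewrite !gt_eqF //; lra.
have := conjugate_powR ta0 ler01 m0 q0 mq.
rewrite mulr1 powR1 => young.
have -> : t `^ m = a `^ m * (t / a) `^ m.
  by rewrite -powRM ?(ltW a0)// mulrC divfK ?gt_eqF.
rewrite ler_pM2l//.
have -> : m / a * t = m * (t / a) by field; rewrite gt_eqF.
move: young; move: ((t / a) `^ m) => y; move: (t / a) => s young.
have : m * s <= m * (y / m + 1 / (m / (m - 1))) by rewrite ler_pM2l.
rewrite (_ : _ * (_ + _) = y + (m - 1)); first by lra.
by field; rewrite !gt_eqF //; lra.
Qed.

(** The quadratic term of the exponential series of m ln a already beats m - 1. *)
Lemma powR_superlinear a : 1 < a ->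
  exists2 c, 0 < c & forall m, 1 < m -> c * m <= a `^ m / (m - 1).
Proof.
move=> a1; have la : 0 < ln a by rewrite ln_gt0.
exists (ln a ^+ 2 / 2); first by rewrite divr_gt0// exprn_gt0.
move=> m m1; rewrite ler_pdivlMr; last by lra.
rewrite /powR gt_eqF; last by lra.
have mla : 0 <= m * ln a by rewrite mulr_ge0// ltW//; lra.
have := expR_ge1Dxn 1 mla; rewrite exprMn (_ : 2`!%:R = 2 :> R)// => expm.
apply: le_trans (_ : m ^+ 2 * ln a ^+ 2 / 2 <= _); last first.
  by apply: le_trans expm; rewrite lerDr.
have : 0 <= ln a ^+ 2 by rewrite sqr_ge0.
move: (ln a ^+ 2) => s s0; rewrite expr2 -subr_ge0.
rewrite (_ : _ - _ = s * m / 2); last by field.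
by rewrite divr_ge0// mulr_ge0//; lra.
Qed.

End powers.

(** * The entropy of a density *)

Section entropy.
Context d (T : measurableType d) (R : realType).
Variable mu : {finite_measure set T -> \bar R}.
Implicit Types rho : bounded_density mu.

Lemma integrable_scale (f : T -> R) (c : R) :
  mu.-integrable setT (EFin \o f) ->
  mu.-integrable setT (EFin \o (fun x => c * f x)).
Proof. by move=> intf; apply: eq_integrable (integrableZl measurableT c intf). Qed.

Lemma Lnorm_density_le1P rho :
  (Lnorm mu +oo (EFin \o rho) <= 1)%E <-> {ae mu, forall x, rho x <= 1}.
Proof.
have -> : (Lnorm mu +oo (EFin \o rho) <= 1)%E <->
    {ae mu, forall x, (`|(rho x)%:E| <= 1)%E}.
  rewrite unlock /=; case: ifPn => [_|mu0]; first by split=> /ess_supP.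
  split=> // _; apply: measure0_ae; apply/eqP.
  by rewrite eq_le measure_ge0 andbT leNgt.
split=> rho1; near=> x.
- have : (`|(rho x)%:E| <= 1)%E by near: x.
  by rewrite lee_fin; exact/le_trans/ler_norm.
- rewrite lee_fin ger0_norm; first by near: x.
  by near: x; exact: density_ge0.
Unshelve. all: by end_near. Qed.

(** If all the sets where rho >= 1 + 1/(k+1) were null, rho would be at most 1
    almost everywhere. *)
Lemma superlevel_set rho : ~ (Lnorm mu +oo (EFin \o rho) <= 1)%E ->
  exists b (A : set T), [/\ 1 < b, measurable A, 0 < fine (mu A) &
    b * fine (mu A) <= \int[mu]_x (rho x * \1_A x)].
Proof.
move=> /Lnorm_density_le1P rho1.
have level_measurable b : measurable [set x | b <= rho x].
  rewrite (_ : [set x | _] = rho @^-1` `[b, +oo[).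
    by rewrite -[X in measurable X]setTI; apply: measurable_density.
  by apply/seteqP; split=> x /=; rewrite in_itv/= andbT.
have [k Ak] : exists k, mu [set x | 1 + k.+1%:R^-1 <= rho x] != 0.
  apply: contrapT => /forallNP A0; apply: rho1.
  have : {ae mu, forall x, forall k, rho x < 1 + k.+1%:R^-1}.
    apply: ae_foralln => k.
    have /negP/negPn/eqP Ak0 := A0 k.
    exists [set x | 1 + k.+1%:R^-1 <= rho x].
    split; [exact: level_measurable|exact: Ak0|].
    by move=> x /= /negP; rewrite -leNgt.
  apply: filterS => x rhox; rewrite leNgt; apply/negP => /ltr_add_invr[k].
  by move=> /lt_trans/(_ (rhox k)); rewrite ltxx.
exists (1 + k.+1%:R^-1), [set x | 1 + k.+1%:R^-1 <= rho x].
have k0 : 0 < k.+1%:R^-1 :> R by rewrite invr_gt0.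
move: k0 Ak; move: (k.+1%:R^-1) => s s0.
have := level_measurable (1 + s); set A := [set x | _] => mA A0.
split=> //; first by lra.
  by rewrite fine_gt0// lt0e A0 measure_ge0 -ge0_fin_numE// fin_num_measure.
have int1 : mu.-integrable setT (EFin \o (\1_A : T -> R)) by exact: integrable_indic.
have -> : fine (mu A) = \int[mu]_x (\1_A x).
  by rewrite /Rintegral integral_indic// setIT.
rewrite -RintegralZl//; apply: le_Rintegral => //.
- exact: integrable_scale.
- exact: (integrable_density_indic rho mA).
- move=> x _; rewrite indicE; case: (boolP (x \in A)) => [|_].
    by rewrite inE /A/= !mulr1.
  by rewrite !mulr0.
Qed.

(** Jensen's inequality on A, obtained by integrating the tangent to t^m at a. *)
Lemma powR_mass_ge rho m a (A : set T) :
  0 < a -> 1 < m -> measurable A ->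
  mu.-integrable setT (fun x => (rho x `^ m)%:E) ->
  a * fine (mu A) <= \int[mu]_x (rho x * \1_A x) ->
  a `^ m * fine (mu A) <= \int[mu]_x (rho x `^ m).
Proof.
move=> a0 m1 mA intm aA.
have int1 : mu.-integrable setT (EFin \o (\1_A : T -> R)) by exact: integrable_indic.
have intA := integrable_density_indic rho mA.
have int2 : mu.-integrable setT (EFin \o (fun x =>
    (1 - m) * \1_A x + m / a * (rho x * \1_A x))).
  have := integrableD measurableT (integrable_scale (1 - m) int1)
    (integrable_scale (m / a) intA).
  by apply: eq_integrable.
have am0 : 0 < a `^ m by exact: powR_gt0.
have mu1 : \int[mu]_x (\1_A x) = fine (mu A).
  by rewrite /Rintegral integral_indic// setIT.
apply: le_trans (_ : \int[mu]_x (a `^ m *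
    ((1 - m) * \1_A x + m / a * (rho x * \1_A x))) <= _).
  rewrite RintegralZl// ler_pM2l// RintegralD//; try exact: integrable_scale.
  rewrite !RintegralZl// mu1.
  have : m / a * (a * fine (mu A)) <= m / a * \int[mu]_x (rho x * \1_A x).
    by rewrite ler_wpM2l// divr_ge0//; lra.
  by rewrite mulrA divfK ?gt_eqF//; lra.
apply: le_Rintegral => //; first exact: integrable_scale.
move=> x _; rewrite indicE; case: (_ \in _).
  by rewrite !mulr1; exact: powR_ge_tangent.
by rewrite !mulr0 addr0 mulr0 powR_ge0.
Qed.

(** For 0 <= t <= 1 and m > 1, t^m <= t. *)
Lemma powR_mass_le1 rho m : 1 < m -> (Lnorm mu +oo (EFin \o rho) <= 1)%E ->
  mu.-integrable setT (fun x => (rho x `^ m)%:E) /\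
  (\int[mu]_x (rho x `^ m)%:E <= 1)%E.
Proof.
move=> m1 /Lnorm_density_le1P rho1.
have rhom : {ae mu, forall x, rho x `^ m <= `|rho x|}.
  near=> x; have r0 : 0 <= rho x by near: x; exact: density_ge0.
  have r1 : rho x <= 1 by near: x.
  rewrite ger0_norm//; move: r0 r1; rewrite le_eqVlt => /predU1P[<- _|r0 r1].
    by rewrite powR0// gt_eqF//; lra.
  have r01 : 0 < rho x <= 1 by rewrite r0 r1.
  by have := ger_powR r01 (ltW m1); rewrite powRr1 ?(ltW r0).
have mm : measurable_fun setT (fun x => (rho x `^ m)%:E).
  apply/measurable_EFinP; apply: (measurableT_comp (measurable_powR _)).
  exact: measurable_density.
split.
  apply: (integrable_ae_le mm _ (integrable_density rho)).
  by apply: filterS rhom => x rx; rewrite /= lee_fin (ger0_norm (powR_ge0 _ _)).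
rewrite -(integral_norm_density rho); apply: ae_ge0_le_integral => //.
- by move=> x _; rewrite lee_fin powR_ge0.
- apply/measurable_EFinP; apply: measurableT_comp => //.
  exact: measurable_density.
- by apply: filterS rhom => x ? _; rewrite lee_fin.
Unshelve. all: by end_near. Qed.

End entropy.

(** * Gamma-convergence of the free energies *)

Section energies.
Context (R : realType) (d : nat) (L : R) (W : 'rV[R]_d -> R).
Hypotheses (L0 : 0 < L) (cW : continuous W).
Local Notation mu := (torus_measure L d).
Implicit Types rho : bounded_density mu.

Let integrable_interaction_integrand rho :
  (mu \x mu)%E.-integrable setT (interaction_integrand W rho).
Proof.
apply: (integrable_interaction rho (measurable_difference_kernel cW)).
exact: step_approximable_difference.
Qed.

Lemma interaction_energy_fin_num rho : interaction_energy W rho \is a fin_num.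
Proof. by rewrite fin_numM// integrable_fin_num. Qed.

Lemma interaction_energy_cvg (rho_ : nat -> bounded_density mu) rho :
  weak_star_cvg rho_ rho ->
  interaction_energy W (rho_ n) @[n --> \oo] --> interaction_energy W rho.
Proof.
move=> rho_cvg; apply: cvgeZl => //.
apply: (interaction_cvg (measurable_difference_kernel cW)) => //.
exact: step_approximable_difference.
Qed.

Variable beta : R.
Hypothesis beta0 : 0 < beta.

(** The lower bound c on the integral of rho^m is required only when that integral
    is finite, since the energy is +oo otherwise. It is used with c = 0, and with the
    exponentially growing c given by [powR_mass_ge]. *)
Lemma free_energy_ge m rho (c : R) : 1 < m ->
  (mu.-integrable setT (fun x => (rho x `^ m)%:E) ->
    c <= \int[mu]_x (rho x `^ m)) ->
  ((beta^-1 / (m - 1) * c)%:E +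
    (- (beta^-1 / (m - 1)))%:E + interaction_energy W rho <=
   free_energy W beta m rho)%E.
Proof.
move=> m1 cS; rewrite /free_energy; case: asboolP => [[intm _]|_]; last exact: leey.
rewrite leeD2r// EFinN leeD2r// EFinM lee_wpmul2l//.
  by rewrite lee_fin divr_ge0 ?invr_ge0 ?ltW// subr_gt0.
have /fineK <- := integrable_fin_num measurableT intm.
by rewrite lee_fin cS.
Qed.

Lemma free_energy_le m rho : 1 < m -> (Lnorm mu +oo (EFin \o rho) <= 1)%E ->
  (free_energy W beta m rho <= interaction_energy W rho)%E.
Proof.
move=> m1 rho1; have [intm S1] := powR_mass_le1 m1 rho1.
rewrite /free_energy asboolT//.
have e0 : 0 <= beta^-1 / (m - 1).
  by rewrite divr_ge0 ?invr_ge0 ?ltW// subr_gt0.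
rewrite -[leRHS]add0e leeD2r// sube_le0.
by rewrite -[leRHS]mule1; exact: lee_wpmul2l.
Qed.

Variable m_ : nat -> R.
Hypotheses (m1 : forall n, 1 < m_ n) (my : m_ n @[n --> \oo] --> +oo).

Lemma entropy_cst_cvg0 : - (beta^-1 / (m_ n - 1)) @[n --> \oo] --> 0.
Proof.
rewrite -oppr0; apply: cvgN; rewrite -[X in _ --> X](mulr0 beta^-1).
apply: cvgM; first exact: cvg_cst.
apply/gtr0_cvgV0; first by apply: nearW => n; rewrite subr_gt0.
apply/cvgryPge => A; have /cvgryPge/(_ (A + 1)) := my.
by apply: filterS => n; rewrite lerBrDr.
Qed.

(** What remains of the energies when the nonnegative part of the entropy is dropped
    has the interaction as its limit. *)
Lemma free_energy_floor_cvg (rho_ : nat -> bounded_density mu) rho :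
  weak_star_cvg rho_ rho ->
  ((- (beta^-1 / (m_ n - 1)))%:E + interaction_energy W (rho_ n) @[n --> \oo]
    --> interaction_energy W rho)%E.
Proof.
move=> rho_cvg; rewrite -[X in (_ --> X)%E]add0e.
apply: cvgeD; last exact: interaction_energy_cvg.
  by rewrite fin_num_adde_defr ?interaction_energy_fin_num.
apply: cvg_EFin; first exact: nearW.
exact: entropy_cst_cvg0.
Qed.

Lemma free_energy_liminf (rho_ : nat -> bounded_density mu) rho :
  weak_star_cvg rho_ rho ->
  (interaction_energy W rho <=
    limn_einf (fun n => free_energy W beta (m_ n) (rho_ n)))%E.
Proof.
move=> rho_cvg; apply: limn_einf_ge_cvg (free_energy_floor_cvg rho_cvg) _.
apply: nearW => n; apply: le_trans (@free_energy_ge _ _ 0 (m1 n) _).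
  by rewrite mulr0 add0e.
by move=> _; apply: Rintegral_ge0 => x _; exact: powR_ge0.
Qed.

Lemma free_energy_blowup (rho_ : nat -> bounded_density mu) rho :
  weak_star_cvg rho_ rho -> ~ (Lnorm mu +oo (EFin \o rho) <= 1)%E ->
  limn_einf (fun n => free_energy W beta (m_ n) (rho_ n)) = +oo%E.
Proof.
move=> rho_cvg /superlevel_set[b [A [b1 mA A0 bA]]].
pose a := (1 + b) / 2; have a1 : 1 < a by rewrite /a; lra.
have ab : a < b by rewrite /a; lra.
have [c c0 ca] := powR_superlinear a1.
set D := fine (mu A) in A0 bA.
have k0 : 0 < beta^-1 * c * D by rewrite !mulr_gt0// invr_gt0.
have near_mass : \forall n \near \oo, a * D <= \int[mu]_x (rho_ n x * \1_A x).
  have aD : a * D < \int[mu]_x (rho x * \1_A x).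
    by apply: lt_le_trans bA; rewrite ltr_pM2r.
  have := cvgr_ge _ (weak_star_cvg_set mA rho_cvg) _ aD.
  exact.
apply/eqP; rewrite -leye_eq.
apply: (@limn_einf_ge_cvg _ _ (fun n => (beta^-1 * c * D * m_ n)%:E +
    ((- (beta^-1 / (m_ n - 1)))%:E + interaction_energy W (rho_ n)))%E).
  rewrite -(@addye _ (interaction_energy W rho)); last first.
    by have := interaction_energy_fin_num rho; case: interaction_energy.
  apply: cvgeD; last exact: free_energy_floor_cvg.
    by rewrite fin_num_adde_defl ?interaction_energy_fin_num.
  apply/cvgeryP/cvgryPge => B; have /cvgryPge/(_ (B / (beta^-1 * c * D))) := my.
  by apply: filterS => n; rewrite ler_pdivrMr// mulrC.
apply: filterS near_mass => n aD.
apply: le_trans (@free_energy_ge _ _ (a `^ m_ n * D) (m1 n) _); last first.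
  by move=> intm; apply: powR_mass_ge => //; lra.
rewrite addeA leeD2r// leeD2r// lee_fin.
rewrite (_ : _ * _ * _ * _ = beta^-1 * D * (c * m_ n)); last by ring.
rewrite (_ : _ / _ * _ = beta^-1 * D * (a `^ m_ n / (m_ n - 1))); last by ring.
by rewrite ler_pM2l ?ca// mulr_gt0// invr_gt0.
Qed.

End energies.

Unset Implicit Arguments.

Theorem theorem6p1 (R : realType) (d : nat) (L : R) (W : 'rV[R]_d -> R)
  (hd : (0 < d)%N) (hL : 0 < L)
  (W_periodic : torus_periodic L W) (W_C2 : Cn 2 W)
  (W_even : coordinatewise_even W)
  (W_mean0 : (\int[torus_measure L d]_x (W (row_of_tuple x))%:E = 0)%E)
  (beta : R) (hbeta : 0 < beta) :
  Gamma_lim_pinfty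
    (@weak_star_cvg _ _ R (torus_measure L d))
    (fun m => @free_energy R d L W beta m)
    (@limit_energy R d L W).
Proof.
move=> m_ m1 my; have cW : continuous W by case: W_C2.
split=> [rho|rho_ rho rho_cvg]; rewrite /limit_energy.
  exists (fun=> rho); first by move=> phi _; exact: cvg_cst.
  case: ifPn => [rho1|_]; last exact: leey.
  by apply: limn_esup_le_bound => n; exact: free_energy_le.
case: ifPn => [_|/negP rho1]; first exact: free_energy_liminf.
by rewrite (free_energy_blowup hL cW hbeta m1 my rho_cvg rho1).
Qed.
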